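(* Let $G$ be a Hausdorff topological group and let $H$ be a dense subgroup of $G$. Then $H$ (with the subspace topology) is locally minimal if and only if $G$ is locally minimal and $H$ is locally essential in $G$.
   Context: Groups are not assumed abelian; the neutral element is denoted $0$. Neighborhoods are not necessarily open. A Hausdorff topological group $(G,\tau)$ is locally minimal if there exists a neighborhood $V$ of $0$ such that whenever $\sigma\subseteq\tau$ is a (coarser) Hausdorff group topology on $G$ for which $V$ is a $\sigma$-neighborhood of $0$, then $\sigma=\tau$. A subgroup $H$ of a topological group $G$ is locally essential in $G$ if there exists a neighborhood $V$ of $0$ in $G$ such that for every closed normal subgroup $N$ of $G$ contained in $V$, $H\cap N=\{0\}$ implies $N=\{0\}$. *)

(* Defs.v *)
From HB Require Import structures.
From mathcomp Require Import all_boot all_order all_algebra.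
From mathcomp Require Import all_classical topology.

Set Implicit Arguments.
Unset Strict Implicit.
Unset Printing Implicit Defensive.

Local Open Scope classical_set_scope.
Local Open Scope group_scope.

(* Groups are not assumed commutative and are written multiplicatively: the
   neutral element is 1. *)
HB.structure Definition PreTopologicalGroup :=
  {G of Topological G & Group G}.

HB.mixin Record PreTopologicalGroup_isTopologicalGroup G
    & PreTopologicalGroup G := {
  mulg_continuous : continuous (fun x : G * G => x.1 * x.2) ;
  invg_continuous : continuous (fun x : G => x^-1)
}.

#[short(type="topologicalGroupType")]
HB.structure Definition TopologicalGroup :=
  {G of PreTopologicalGroup G & PreTopologicalGroup_isTopologicalGroup G}.

(* A term sigma : Topological G is a topology on the carrier G. When G is
   already a topologicalType, [topologized sigma] is the same carrier with
   sigma in place of the canonical topology. *)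
Definition topologized (G : Type) (sigma : Topological G) : topologicalType :=
  Topological.Pack sigma.

Definition group_topology (G : groupType) (sigma : Topological G) : Prop :=
  let S := topologized sigma in
  continuous (fun x : S * S => (x.1 : G) * x.2 : S) /\
  continuous (fun x : S => (x : G)^-1 : S).

Definition locally_minimal (G : topologicalGroupType) : Prop :=
  exists2 V : set G, nbhs (1 : G) V &
    forall sigma : Topological G,
      let S := topologized sigma in
      group_topology sigma -> hausdorff_space S ->
      (@open S : set (set G)) `<=` @open G ->
      nbhs (1 : S) V ->
      (@open S : set (set G)) = @open G.

Definition normal_subgroup (G : groupType) (N : set G) : Prop :=
  group_closed (mem N) /\ forall x y, N x -> N (x ^ y).

Definition locally_essential (G : topologicalGroupType) (H : set G) : Prop :=
  exists2 V : set G, nbhs (1 : G) V &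
    forall N : set G, normal_subgroup N -> closed N -> N `<=` V ->
      H `&` N = [set 1] -> N = [set 1].

(* For H : subGroupType P, the map val is an injective group morphism H -> G
   with image P, so the topology it induces on H is the subspace topology. *)
Section SubspaceTopology.
Context (G : topologicalGroupType) (P : {pred G}) (H : subGroupType P).

Definition subspace_group := initial_topology (val : H -> G).

HB.instance Definition _ := Topological.on subspace_group.
HB.instance Definition _ := Group.copy subspace_group H.

Let val_cts : continuous (val : subspace_group -> G).
Proof. exact: initial_continuous. Qed.

Let subspace_mulg_continuous :
  continuous (fun x : subspace_group * subspace_group => x.1 * x.2).
Proof.
apply: continuous_comp_initial => x.
rewrite [_ \o _](_ : _ = (fun z : G * G => z.1 * z.2) \o
    (fun z : subspace_group * subspace_group => (val z.1, val z.2))); last first.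
  by apply/funext => z /=; rewrite valM.
apply: continuous_comp; last exact: mulg_continuous.
by apply: cvg_pair; apply: continuous_comp;
  [exact: cvg_fst | exact: val_cts | exact: cvg_snd | exact: val_cts].
Qed.

Let subspace_invg_continuous : continuous (fun x : subspace_group => x^-1).
Proof.
apply: continuous_comp_initial => x.
rewrite [_ \o _](_ : _ = (fun z : G => z^-1) \o
    (val : subspace_group -> G)); last first.
  by apply/funext => z /=; rewrite -(gmulfV (val : H -> G)).
by apply: continuous_comp; [exact: val_cts | exact: invg_continuous].
Qed.

HB.instance Definition _ := PreTopologicalGroup_isTopologicalGroup.Build
  subspace_group subspace_mulg_continuous subspace_invg_continuous.

End SubspaceTopology.

(* Main.v *)
(* A group topology is determined by its filter of neighborhoods of 1, so local
   minimality is a statement about such filters. Write T for that of G.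

   A filter F <= T with the same trace on the dense subgroup H as T equals T:
   for U in F, a slightly smaller V in F lies in the T-closure of U `&` H, and
   T has a base of closed sets. When H is locally minimal, this applies to
   every F containing a fixed W in T whose trace on H is Hausdorff: to
   Hausdorff F, whence G is locally minimal, and to F = {U N | U in T} for a
   small closed normal N meeting H trivially, whence N lies in every
   neighborhood of 1.

   Conversely, the T-closures of the neighborhoods of 1 of a coarser Hausdorff
   group topology on H form such a filter E <= T on G. The intersection of E is
   a small closed normal subgroup meeting H trivially, hence trivial by local
   essentiality; local minimality of G gives E = T, and then H carries its
   original topology. *)

Require Import Defs.
From HB Require Import structures.
From mathcomp Require Import all_boot all_order all_algebra.
From mathcomp Require Import all_classical topology.

Set Implicit Arguments.
Unset Strict Implicit.
Unset Printing Implicit Defensive.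

Local Open Scope classical_set_scope.
Local Open Scope group_scope.

(** * Group topologies as filters of neighborhoods of 1 *)

(** These axioms characterize the neighborhood filters of 1 in group topologies, Hausdorff or not.
    In the absence of commutativity, invariance under conjugation has to be required. *)
Record group_nbhs (G : groupType) (F : set_system G) : Prop := GroupNbhs {
  group_nbhs_filter : Filter F;
  group_nbhs1 : forall A, F A -> A 1;
  group_nbhsM : forall A, F A ->
    exists2 B, F B & forall x y, B x -> B y -> A (x * y);
  group_nbhsV : forall A, F A -> F [set x | A x^-1];
  group_nbhsJ : forall A g, F A -> F [set x | A (x ^ g)]
}.

Definition separated (G : groupType) (F : set_system G) :=
  forall x, (forall A, F A -> A x) -> x = 1.

Section TopologyOfNbhs.
Context (G : groupType) (F : set_system G) (F_nbhs : group_nbhs F).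

Let FF : Filter F := group_nbhs_filter F_nbhs.
Local Existing Instance FF.

Let translated (x : G) : set_system G := [set A | F [set y | A (x * y)]].

Let translated_filter x : ProperFilter (translated x).
Proof.
have ? : Filter (translated x); last first.
  apply: Build_ProperFilter_ex => A /(group_nbhs1 F_nbhs) A1.
  by exists (x * 1).
split.
- exact: filterT.
- by move=> A B; exact: filterI.
- by move=> A B AB; apply: filterS => y; exact: AB.
Qed.

Let translated_singleton x A : translated x A -> A x.
Proof. by move/(group_nbhs1 F_nbhs); rewrite /= mulg1. Qed.

Let translated_translated x A : translated x A -> translated x (translated^~ A).
Proof.
move=> /(group_nbhsM F_nbhs)[B FB BA].
rewrite /translated /=; apply: (filterS _ FB) => y By /=.
by apply: (filterS _ FB) => z Bz /=; rewrite -mulgA; exact: BA.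
Qed.

(** An alias of [G] indexed by the proof, so that the topology attached to it can depend on [F]. *)
Definition translation_topology of group_nbhs F : Type := G.
Let S := translation_topology F_nbhs.
HB.instance Definition _ := Choice.on S.
HB.instance Definition _ := hasNbhs.Build S translated.
HB.instance Definition _ := Nbhs_isNbhsTopological.Build S
  translated_filter translated_singleton translated_translated.

Lemma group_nbhs_topology : exists2 sigma : Topological G,
  group_topology sigma & nbhs (1 : topologized sigma) = F.
Proof.
exists (Topological.class S); last first.
  apply/funext => A; rewrite /nbhs /= /translated /=.
  by under eq_fun do rewrite mul1g.
split=> [[x y]|x] A.
  move=> /(group_nbhsM F_nbhs)[B FB BA].
  (* For [p = x b] and [q = y c], one has [p q = x y (b ^ y) c]; hence [b ^ y] and [c] are asked to
     lie in [B]. *)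
  exists ([set p | B ((x^-1 * p) ^ y)], [set q | B (y^-1 * q)]) => /=.
    split.
      suff : F [set z | B ((x^-1 * (x * z)) ^ y)] by [].
      by under eq_fun do rewrite mulKg; exact: (group_nbhsJ F_nbhs y FB).
    suff : F [set z | B (y^-1 * (y * z))] by [].
    by under eq_fun do rewrite mulKg.
  move=> [p q] [/= Bp Bq]; have /= := BA _ _ Bp Bq.
  by rewrite conjgE -!mulgA !(mulVKg, mulKg).
(* This rests on [(x z)^-1 = x^-1 (z^-1 ^ x^-1)]. *)
move=> /(group_nbhsJ F_nbhs x^-1)/(group_nbhsV F_nbhs) FA.
suff : F [set z | A (x * z)^-1] by [].
by apply: filterS FA => z /=; rewrite conjgE invgK mulKg invgM.
Qed.

End TopologyOfNbhs.

Section NbhsOfTopology.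
Context (G : groupType) (sigma : Topological G).
Hypothesis sigma_group : group_topology sigma.

Let S := topologized sigma.
Let F : set_system G := nbhs (1 : S).
Let FF : Filter F := nbhs_filter (1 : S).
Local Existing Instance FF.

Let mulg_nbhs (x y : G) A : nbhs (x * y : S) A ->
  exists2 B : set G * set G, nbhs (x : S) B.1 /\ nbhs (y : S) B.2 &
    forall p q, B.1 p -> B.2 q -> A (p * q).
Proof.
move=> /(sigma_group.1 (x, y))[B [B1 B2] BA].
by exists B => // p q Bp Bq; exact: (BA (p, q)).
Qed.

Lemma nbhs_translate (x y : G) A :
  nbhs (x * y : S) A -> nbhs (y : S) [set z | A (x * z)].
Proof.
move=> /mulg_nbhs[B [/nbhs_singleton B1 B2] BA].
by apply: filterS B2 => z Bz; exact: BA.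
Qed.

Lemma nbhs_group1E (x : G) A : nbhs (x : S) A <-> F [set y | A (x * y)].
Proof.
split=> [|FA]; first by rewrite -{1}[x]mulg1; exact: nbhs_translate.
have : nbhs (x^-1 * x : S) [set y | A (x * y)] by rewrite mulVg.
by move/nbhs_translate; apply: filterS => y /=; rewrite mulVKg.
Qed.

Lemma group_topology_nbhs : group_nbhs F.
Proof.
split=> //.
- by move=> A; exact: nbhs_singleton.
- move=> A FA; have /mulg_nbhs[B [B1 B2] BA] : nbhs (1 * 1 : S) A.
    by rewrite mulg1.
  exists (B.1 `&` B.2); first exact: filterI.
  by move=> x y [Bx _] [_ By]; exact: BA.
- by move=> A FA; apply: (sigma_group.2 (1 : S)); rewrite /= invg1.
- move=> A g FA.
  have /nbhs_translate Ag : nbhs (g^-1 * g : S) A by rewrite mulVg.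
  have /mulg_nbhs[B [B1 /nbhs_singleton B2] BA] :
      nbhs (1 * g : S) [set z | A (g^-1 * z)] by rewrite mul1g.
  by apply: filterS B1 => x Bx; exact: BA.
Qed.

Lemma group_hausdorffP : hausdorff_space S <-> separated F.
Proof.
have FN := group_topology_nbhs; split=> [hS x Fx|sepF x y xy].
  apply/esym/hS => A B /Fx Ax /nbhs_singleton Bx.
  by exists x.
apply: (@mulgI G x^-1); rewrite mulVg; apply/esym/sepF => A.
move=> /(group_nbhsM FN)[B FB BA].
(* A common point [p] of [x B] and [y B^-1] gives [x^-1 y = (x^-1 p) (p^-1 y)] in [B B]. *)
have [||p [/= Bxp Byp]] :=
  xy [set p | B ((x : G)^-1 * p)] [set p | B ((y : G)^-1 * p)^-1].
- by apply/nbhs_group1E => /=; under eq_fun do rewrite mulKg.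
- apply/nbhs_group1E => /=; under eq_fun do rewrite mulKg.
  exact: group_nbhsV.
- by have := BA _ _ Bxp Byp; rewrite invgM invgK -mulgA mulVKg.
Qed.

End NbhsOfTopology.

Lemma group_open_subset (G : groupType) (sigma tau : Topological G) :
  group_topology sigma -> group_topology tau ->
  (@open (topologized sigma) : set (set G)) `<=` @open (topologized tau) <->
  (nbhs (1 : topologized sigma) : set (set G)) `<=`
    nbhs (1 : topologized tau).
Proof.
move=> gs gt; split=> [st A|st A].
  by rewrite !nbhsE => -[B [/st oB B1] BA]; exists B.
rewrite !openE => oA x /oA /(nbhs_group1E gs)/st xA.
exact/(nbhs_group1E gt).
Qed.

Lemma topologicalGroup_group_topology (G : topologicalGroupType) :
  group_topology (Topological.class G).
Proof. by split; [exact: mulg_continuous | exact: invg_continuous]. Qed.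

Lemma topologicalGroup_nbhs (G : topologicalGroupType) :
  group_nbhs (nbhs (1 : G)).
Proof. exact: group_topology_nbhs (@topologicalGroup_group_topology G). Qed.

(** Trades topologies for filters: a competitor on [G] or H then only has to satisfy
    [group_nbhs]. *)
Lemma locally_minimalP (G : topologicalGroupType) : locally_minimal G <->
  exists2 V, nbhs (1 : G) V & forall F : set_system G,
    group_nbhs F -> separated F -> F `<=` nbhs (1 : G) -> F V ->
    nbhs (1 : G) `<=` F.
Proof.
have gG := @topologicalGroup_group_topology G.
split=> -[V V1 minV]; exists V => //.
  move=> F /group_nbhs_topology[sigma gs <-] sepF Fle FV.
  apply/(group_open_subset gG gs); rewrite (minV sigma) //.
  - exact/group_hausdorffP.
  - exact/(group_open_subset gs gG).
move=> sigma S gs hS Sle SV; apply/seteqP; split=> //.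
apply/(group_open_subset gG gs); apply: minV => //.
- exact: group_topology_nbhs.
- exact/group_hausdorffP.
- exact/(group_open_subset gs gG).
Qed.

(** * Closures and conjugation in a topological group *)

Lemma nbhs_group1 (G : topologicalGroupType) (x : G) (A : set G) :
  nbhs x A <-> nbhs 1 [set y | A (x * y)].
Proof. exact: (nbhs_group1E (@topologicalGroup_group_topology G)). Qed.

(** If [x] is in the closure of [B], then [x B^-1] meets [B], so [x] is in [B B]. *)
Lemma group_nbhs_regular (G : topologicalGroupType) (A : set G) :
  nbhs 1 A -> exists2 B, nbhs 1 B & closure B `<=` A.
Proof.
have TN := @topologicalGroup_nbhs G.
move=> /(group_nbhsM TN)[B TB BA]; exists B => // x Bx.
have [|p [/= Bp Bxp]] := Bx [set p | B (x^-1 * p)^-1].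
  apply/nbhs_group1 => /=; under eq_fun do rewrite mulKg.
  exact: group_nbhsV.
by have := BA _ _ Bp Bxp; rewrite invgM invgK mulVKg.
Qed.

Lemma closureM (G : topologicalGroupType) (A B C : set G) :
  (forall x y, A x -> B y -> C (x * y)) ->
  forall x y, closure A x -> closure B y -> closure C (x * y).
Proof.
move=> ABC x y Ax By U /(@mulg_continuous G (x, y))[[V W] [/=]].
move=> /Ax[a [Aa Va]] /By[b [Bb Wb]] VWU.
by exists (a * b); split; [exact: ABC | exact: (VWU (a, b))].
Qed.

Lemma conjg_continuous (G : topologicalGroupType) (g : G) :
  continuous (fun x : G => x ^ g).
Proof.
move=> x A /nbhs_group1/(group_nbhsJ (@topologicalGroup_nbhs G) g) xA.
by apply/nbhs_group1; apply: filterS xA => y; rewrite /= conjMg.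
Qed.

Lemma closure_homo (S T : topologicalType) (f : S -> T)
    (A : set S) (B : set T) :
  continuous f -> (forall x, A x -> B (f x)) ->
  forall x, closure A x -> closure B (f x).
Proof.
move=> cf AB x Ax U /cf/Ax[y [Ay Uy]].
by exists (f y); split; [exact: AB | ].
Qed.

(** * Filters induced by a morphism and by a normal subgroup *)

Section GroupNbhsPreimage.
Context (G H : groupType) (f : H -> G) (F : set_system G).
Hypothesis fM : {morph f : x y / x * y}.
Hypothesis F_nbhs : group_nbhs F.

Definition preimage_nbhs : set_system H := filter_from F (preimage f).

Lemma group_nbhs_preimage : group_nbhs preimage_nbhs.
Proof.
have FF := group_nbhs_filter F_nbhs.
have f1 : f 1 = 1 by apply: (@mulgI G (f 1)); rewrite -fM !mulg1.
have fV x : f x^-1 = (f x)^-1 by apply: (@mulgI G (f x)); rewrite -fM !mulgV.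
split.
- apply: filter_from_filter; first by exists setT; exact: filterT.
  by move=> A B FA FB; exists (A `&` B) => //; exact: filterI.
- by move=> A [U FU]; apply; rewrite /= f1; exact: (group_nbhs1 F_nbhs).
- move=> A [U /(group_nbhsM F_nbhs)[V FV VU] UA]; exists (f @^-1` V).
    by exists V.
  by move=> x y Vx Vy; apply: UA; rewrite /= fM; exact: VU.
- move=> A [U /(group_nbhsV F_nbhs) FU UA].
  exists [set x | U x^-1] => // x /= Ux.
  by apply: UA; rewrite /= fV.
- move=> A g [U /(group_nbhsJ F_nbhs (f g)) FU UA].
  exists [set x | U (x ^ f g)] => // x /= Ux.
  by apply: UA; rewrite /= !conjgE !fM fV.
Qed.

End GroupNbhsPreimage.

Section GroupNbhsMulNormal.
Context (G : groupType) (N : set G) (F : set_system G).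
Hypothesis N_normal : normal_subgroup N.
Hypothesis F_nbhs : group_nbhs F.

(* The neighborhoods of 1 in the preimage of the quotient topology of G / N. *)
Definition normal_nbhs : set_system G :=
  filter_from F (fun U => [set u * n | u in U & n in N]).

Lemma normal_subgroupP : [/\ N 1, forall x y, N x -> N y -> N (x * y),
  forall x, N x -> N x^-1 & forall x y, N x -> N (x ^ y)].
Proof.
have [gN NJ] := N_normal.
have memN x : (x \in mem N) = (x \in N) by [].
split=> //.
- by have := gN.1; rewrite memN inE.
- move=> x y Nx Ny; have := group_closedM gN (mem_set Nx) (mem_set Ny).
  by rewrite memN inE.
- by move=> x Nx; have := group_closedV gN (mem_set Nx); rewrite memN inE.
Qed.

(** By normality, factors in [N] move to the right: [(u m) (v n) = (u v) ((m ^ v) n)] and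
    [(u n)^-1 = u^-1 (n^-1 ^ u^-1)]. *)
Lemma group_nbhs_normal : group_nbhs normal_nbhs.
Proof.
have [N1 NM NV NJ] := normal_subgroupP; have FF := group_nbhs_filter F_nbhs.
split.
- apply: filter_from_filter; first by exists setT; exact: filterT.
  move=> A B FA FB; exists (A `&` B); first exact: filterI.
  by move=> _ [u [Au Bu] [n Nn <-]]; split; exists u => //; exists n.
- move=> A [U /(group_nbhs1 F_nbhs) U1]; apply.
  by exists 1 => //; exists 1 => //; rewrite mulg1.
- move=> A [U /(group_nbhsM F_nbhs)[V FV VU] UA].
  exists [set u * n | u in V & n in N]; first by exists V.
  move=> _ _ [u Vu [m Nm <-]] [v Vv [n Nn <-]]; apply: UA.
  exists (u * v); first exact: VU.
  exists (m ^ v * n); first by apply: NM => //; exact: NJ.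
  by rewrite conjgE -!mulgA mulVKg.
- move=> A [U /(group_nbhsV F_nbhs) FU UA]; exists [set x | U x^-1] => //.
  move=> _ [u Uu [n Nn <-]]; apply: UA; exists u^-1 => //.
  exists (n^-1 ^ u^-1); first by apply: NJ; exact: NV.
  by rewrite conjgE invgK mulKg invgM.
- move=> A g [U /(group_nbhsJ F_nbhs g) FU UA].
  exists [set x | U (x ^ g)] => //.
  move=> _ [u Uu [n Nn <-]]; apply: UA; exists (u ^ g) => //.
  by exists (n ^ g); [exact: NJ | rewrite conjMg].
Qed.

End GroupNbhsMulNormal.

(** * Filters on a group and on its dense subgroup *)

Section DenseSubgroup.
Context (G : topologicalGroupType) (P : {pred G}) (H : subGroupType P).
Hypothesis P_dense : dense [set` P].

Let S : topologicalGroupType := subspace_group H.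
Let f : S -> G := val.
Let fM : {morph f : x y / x * y} := @valM _ _ H.
Let fV : {morph f : x / x^-1} := gmulfV (val : H -> G).
Let TN : group_nbhs (nbhs (1 : G)) := @topologicalGroup_nbhs G.

Lemma range_val : range f = [set` P].
Proof.
apply/seteqP; split=> [_ [x _ <-]|x Px]; first exact: valP.
by exists (Sub x Px) => //; exact: SubK.
Qed.

Lemma nbhs_subspace_group :
  nbhs (1 : S) = preimage_nbhs f (nbhs (1 : G)).
Proof.
apply/seteqP; split=> A.
  rewrite nbhsE => -[B [[U oU UB] B1] BA].
  exists U; last by rewrite UB.
  by apply: open_nbhs_nbhs; split => //; move: B1; rewrite -UB /= val1.
move=> [U U1 UA]; apply: filterS UA _.
by apply: (@initial_continuous _ _ f (1 : S)); rewrite /f val1.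
Qed.

Lemma dense_subset_closure (x : G) (U : set G) :
  nbhs x U -> closure (U `&` range f) x.
Proof.
rewrite range_val => xU B xB.
have xUB : nbhs x (U `&` B)° by apply: nbhs_interior; exact: filterI.
have [|y [/interior_subset[Uy By] Py]] := P_dense _ (open_interior (U `&` B)).
  by exists x; exact: nbhs_singleton.
by exists y.
Qed.

Lemma dense_coarser_eq (F : set_system G) : group_nbhs F -> F `<=` nbhs 1 ->
  preimage_nbhs f (nbhs (1 : G)) `<=` preimage_nbhs f F -> nbhs (1 : G) `<=` F.
Proof.
move=> FN FT TF A /group_nbhs_regular[B TB BA].
have FF := group_nbhs_filter FN.
have [|U FU UB] := TF (f @^-1` B); first by exists B.
have [V FV VU] := group_nbhsM FN FU; have TV := FT _ FV.
(* Since [x V] lies in [U] and [V] is a neighborhood of 1 in [G], [U] is a neighborhood of [x]. By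
   density [x] is in the closure of the trace of [U], which lies in [B]. *)
apply: filterS FV => x Vx; apply: BA.
apply: (@closureS _ (U `&` range f)).
  by move=> _ [/[swap]-[h _ <-]]; exact: UB.
apply/dense_subset_closure/nbhs_group1; apply: filterS TV => y Vy.
exact: VU.
Qed.

Section Extension.
Variable F : set_system S.
Hypothesis F_nbhs : group_nbhs F.
Hypothesis F_coarser : F `<=` nbhs (1 : S).

Let FF : Filter F := group_nbhs_filter F_nbhs.
Local Existing Instance FF.

Definition closure_nbhs : set_system G :=
  filter_from F (fun U => closure (f @` U)).

Lemma closure_nbhs_coarser : closure_nbhs `<=` nbhs 1.
Proof.
move=> A [U /F_coarser]; rewrite nbhs_subspace_group => -[O TO OU] UA.
have TO' := nbhs_interior TO; apply: filterS TO' => x Ox; apply: UA.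
apply: closureS (dense_subset_closure Ox) => _ [/[swap]-[h _ <-]] Oh.
by exists h => //; exact: OU.
Qed.

(** Products and inverses pass to closures by continuity. The delicate axiom is conjugation by an
    element of [G] outside H, which need not map H to itself. *)
Lemma group_nbhs_closure : group_nbhs closure_nbhs.
Proof.
have closure_mul (U V : set S) : (forall x y, V x -> V y -> U (x * y)) ->
    forall x y, closure (f @` V) x -> closure (f @` V) y ->
    closure (f @` U) (x * y).
  move=> VU; apply: closureM => _ _ [x Vx <-] [y Vy <-].
  by exists (x * y); [exact: VU | exact: fM].
split.
- apply: filter_from_filter; first by exists setT; exact: filterT.
  move=> U V FU FV; exists (U `&` V); first exact: filterI.
  by move=> x UVx; split; apply: closureS UVx => _ [y [Uy Vy] <-]; exists y.
- move=> A [U FU]; apply; apply: subset_closure; exists 1; last exact: (val1 H).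
  exact: (group_nbhs1 F_nbhs).
- move=> A [U /(group_nbhsM F_nbhs)[V FV VU] UA].
  exists (closure (f @` V)); first by exists V.
  by move=> x y Vx Vy; apply: UA; exact: closure_mul Vx Vy.
- move=> A [U /(group_nbhsV F_nbhs) FU UA].
  exists [set x | U x^-1] => // x Ux; apply: UA.
  apply: (closure_homo (@invg_continuous G) _ Ux) => _ [y Uy <-].
  by exists y^-1.
- move=> A g [U /(group_nbhsM F_nbhs)[V FV VU] UA].
  have [W0 FW0 WV0] := group_nbhsM F_nbhs FV.
  (* With this choice [W W] lies in [V] and [W W W] in [U], as needed for the three factors of
     [x ^ g] below. *)
  pose W := W0 `&` V; have FW : F W by exact: filterI.
  have TW : nbhs 1 (closure (f @` W)) by apply: closure_nbhs_coarser; exists W.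
  have TWV := group_nbhsV TN TW.
  (* Conjugation by [g] is reduced to conjugation by some [h] in H close to
     [g], H being dense and the closure of [W] a neighborhood of 1 in G. *)
  have [||_ [[_ [h _ <-]] [/= Wp Wp']]] := @dense_subset_closure g setT _
      [set p | closure (f @` W) (p^-1 * g) /\ closure (f @` W) (g^-1 * p)].
  + exact: filterT.
  + apply/nbhs_group1; apply: filterS (filterI TW TWV) => y [Wy WyV].
    by rewrite /= invgM mulgVK mulKg.
  exists [set x | W (x ^ h)]; first exact: group_nbhsJ.
  move=> x Wx; apply: UA.
  have {}Wx : closure (f @` W) (x ^ f h).
    apply: (closure_homo (@conjg_continuous G (f h)) _ Wx) => _ [y Wy <-].
    by exists (y ^ h) => //; rewrite !conjgE !fM fV.
  have -> : x ^ g = (g^-1 * f h) * x ^ f h * ((f h)^-1 * g).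
    by rewrite !conjgE -!mulgA !mulVKg.
  apply: (closure_mul U V) => //.
    apply: (closure_mul V W) => //.
    by move=> y z [Wy _] [Wz _]; exact: WV0.
  by apply: closureS Wp => _ [y [_ Vy] <-]; exists y.
Qed.

(** As [F] is coarser, [h V^-1] contains the trace of a neighborhood of [h] in [G], so it meets [V]
    and [h] is in [V V]. For separated [F], the intersection of [closure_nbhs F] thus meets H
    trivially. *)
Lemma closure_nbhs_preimage h :
  (forall A, closure_nbhs A -> A (f h)) -> forall U, F U -> U h.
Proof.
move=> clh U /(group_nbhsM F_nbhs)[V FV VU].
have := F_coarser (group_nbhsV F_nbhs FV).
rewrite nbhs_subspace_group => -[O TO OV].
have : closure (f @` V) (f h) by apply: clh; exists V.
have hO : nbhs (f h) [set p | O ((f h)^-1 * p)].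
  by apply/nbhs_group1; apply: filterS TO => y /=; rewrite mulKg.
move=> /(_ _ hO)[_ [[v Vv <-] /= Ov]].
have {}Ov : V (h^-1 * v)^-1.
  by apply: OV; rewrite /= fM fV.
by have := VU _ _ Vv Ov; rewrite invgM invgK mulVKg.
Qed.

End Extension.

End DenseSubgroup.

(** * Local minimality of a dense subgroup *)

(** The intersection is the closure of 1 in the group topology given by [F]. *)
Lemma normal_subgroup_bigcap (G : groupType) (F : set_system G) :
  group_nbhs F -> normal_subgroup (\bigcap_(A in F) A).
Proof.
move=> FN; split; first split.
- by apply/mem_set => A; exact: (group_nbhs1 FN).
- move=> x y /set_mem Fx /set_mem Fy; apply/mem_set => A.
  move=> /(group_nbhsM FN)[B FB]; apply; first exact: Fx.
  by apply: (Fy [set z | B z^-1]); exact: (group_nbhsV FN).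
- by move=> x y Fx A /(group_nbhsJ FN y)/Fx.
Qed.

Lemma separated_nbhs (G : topologicalGroupType) :
  hausdorff_space G -> separated (nbhs (1 : G)).
Proof.
by move=> hG; apply/(group_hausdorffP (@topologicalGroup_group_topology G)).
Qed.

Theorem theorem3p5 (G : topologicalGroupType) (P : {pred G})
    (H : subGroupType P) :
  hausdorff_space G -> dense [set` P] ->
  locally_minimal (subspace_group H) <->
  locally_minimal G /\ locally_essential [set` P].
Proof.
move=> hG dP; set S := subspace_group H; pose f : S -> G := val.
have fM : {morph f : x y / x * y} := @valM _ _ H.
have TN := @topologicalGroup_nbhs G.
have sep := separated_nbhs hG.
split=> [/locally_minimalP[V0]|[/locally_minimalP[V1 TV1 minV] [V2 TV2 essV]]].
  rewrite nbhs_subspace_group => -[W TW WV] minV.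
  (* Only the trace of [F] has to be separated, so this also covers the filter of [U N], not known
     to be separated on [G]. *)
  have finer F : group_nbhs F -> F `<=` nbhs 1 -> F W ->
      separated (preimage_nbhs f F) -> nbhs 1 `<=` F.
    move=> FN FT FW sepF; apply: (dense_coarser_eq (H := H)) => //.
    apply: minV.
    - exact: (group_nbhs_preimage fM FN).
    - exact: sepF.
    - by move=> A [U /FT TU UA]; exists U.
    - by exists W.
  split.
    apply/locally_minimalP; exists W => // F FN sepF FT FW.
    apply: finer => // x Fx; apply/val_inj; rewrite val1; apply: sepF => A FA.
    by apply: (Fx (f @^-1` A)); exists A.
  (* For [N] inside [B], this makes [B N] a subset of [W]. *)
  have [B TB BW] := group_nbhsM TN TW.
  exists B => // N nN cN NB PN; have [N1 NM NV NJ] := normal_subgroupP nN.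
  have TF : nbhs 1 `<=` normal_nbhs N (nbhs 1).
    apply: finer.
    - exact: group_nbhs_normal.
    - move=> A [U TU UA]; apply: filterS TU => x Ux; apply: UA.
      by exists x => //; exists 1 => //; rewrite mulg1.
    - by exists B => // _ [x Bx [n /NB Bn <-]]; exact: BW.
    move=> x Fx; apply/val_inj; rewrite val1.
    suff : ([set` P] `&` N) (f x) by rewrite PN.
    split; first exact: valP.
    (* A point [x] of H in every [U N] is in the closed set [N]: if [x = u n], then
       [n = u^-1 x = x (u^-1 ^ x)], which is in [A] for [u] in the [U] below. *)
    apply: cN => A /nbhs_group1/(group_nbhsJ TN (f x))/(group_nbhsV TN) TA.
    pose U := [set u | A (f x * u^-1 ^ f x)].
    have [|u /= + [n Nn unx]] := Fx (f @^-1` [set u * n | u in U & n in N]).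
      by exists [set u * n | u in U & n in N] => //; exists U.
    by rewrite /U /= -conjgC -unx mulKg; exists n.
  (* Every neighborhood of 1 contains some [U N], hence all of [N]. *)
  apply/seteqP; split=> [n Nn|_ -> //]; apply: sep => A /TF[U TU]; apply.
  by exists 1; [exact: nbhs_singleton | exists n => //; rewrite mul1g].
apply/locally_minimalP.
(* The closure of [B] yields a member of [closure_nbhs F] inside both [V1], for minimality, and
   [V2], for essentiality. *)
have [B TB BV] := group_nbhs_regular (filterI TV1 TV2).
exists (f @^-1` B); first by rewrite nbhs_subspace_group; exists B.
move=> F FN sepF FT FB.
have FF := group_nbhs_filter FN.
have EN := group_nbhs_closure dP FN FT.
have EB A : closure B `<=` A -> closure_nbhs F A.
  move=> BA; exists (f @^-1` B) => // x Bx; apply/BA.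
  by apply: closureS Bx => _ [y By <-].
have TE : nbhs 1 `<=` closure_nbhs F.
  apply: minV => //; last 2 first.
  - exact: closure_nbhs_coarser.
  - by apply: EB => x /BV[].
  suff E1 : \bigcap_(A in closure_nbhs F) A = [set 1].
    by move=> x Ex; rewrite -[x = 1]/([set 1] x) -E1.
  apply: essV.
  - exact: normal_subgroup_bigcap.
  (* The intersection is closed because closed sets generate the filter. *)
  - move=> x Ex A [U FU]; apply; apply: closed_closure; apply: closureS Ex.
    by move=> y; apply; exists U.
  - by move=> x; apply; apply: EB => y /BV[].
  apply/seteqP; split=> [x [Px Ex]|_ ->]; last first.
    split; first by rewrite -(val1 H); exact: valP.
    by move=> A; exact: (group_nbhs1 EN).
  have fx : f (Sub x Px) = x by exact: SubK.
  suff x1 : (Sub x Px : S) = 1 by rewrite /= -fx x1; exact: val1.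
  apply: sepF; apply: (closure_nbhs_preimage FN FT) => A /Ex.
  by rewrite -{1}fx.
(* [O] contains the closure of some [U] in [F], so its trace on H contains [U]. *)
rewrite nbhs_subspace_group => A [O /TE[U FU UO] OA].
by apply: filterS FU => x Ux; apply/OA/UO/subset_closure; exists x.
Qed.
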